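(* In the wavelength restricted setting, where each fiber is used by at most $W$ of the given paths, the Additive Cost Greedy algorithm provides an $O(W\log m)$ approximation to the MFSP problem, where $m$ is the number of fibers. That is, it outputs a survivable path set using at most $O(W\log m)\cdot\xi$ fibers, where $\xi$ is the minimum number of fibers used by a survivable path set.
   Context: There are $m$ fibers (links of a physical topology) and a given set of logical $s$-$t$ paths $P_1,\dots,P_n$, each with an associated set of fibers that it uses; a path survives a fiber if it does not use it. Wavelength restriction: each fiber is used by at most $W$ of the given paths. A set of given paths is survivable if for every fiber at least one path of the set survives that fiber. The MFSP problem is to find a survivable path set minimizing the total number of distinct fibers used by the paths in the set (a fiber used by several selected paths is counted once). Only instances admitting a survivable path set are considered. Additive Cost Greedy algorithm: let $C_j$ be the number of fibers used by path $P_j$ (this does not change over iterations). In each iteration define the amortized cost of each remaining path as $AC_j = C_j/(\text{number of fibers survived by }P_j\text{ and not survived by the previously selected paths})$. Select a path with minimum amortized cost, update the amortized costs of the remaining paths, and continue until all fibers are survived by the selected paths; output the selected paths. *)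

(* Defs.v *)
From mathcomp Require Import all_boot all_order all_algebra.
From mathcomp Require Import constructive_ereal.

Set Implicit Arguments.
Unset Strict Implicit.
Unset Printing Implicit Defensive.

Import Order.TTheory GRing.Theory Num.Theory.

(* An instance with m fibers and n given paths is [P : 'I_n -> {set 'I_m}],
   where [P j] is the set of fibers used by the j-th path.  Paths are indexed,
   so distinct paths may use the same set of fibers. *)

Definition survives (m n : nat) (P : 'I_n -> {set 'I_m}) (j : 'I_n)
    (f : 'I_m) : bool :=
  f \notin P j.

Definition wavelength_restricted (m n : nat) (P : 'I_n -> {set 'I_m})
    (W : nat) : Prop :=
  forall f : 'I_m, #|[set j : 'I_n | f \in P j]| <= W.

Definition survivable (m n : nat) (P : 'I_n -> {set 'I_m})
    (S : {set 'I_n}) : Prop :=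
  forall f : 'I_m, exists2 j : 'I_n, j \in S & survives P j f.

Definition num_fibers (m n : nat) (P : 'I_n -> {set 'I_m})
    (S : {set 'I_n}) : nat :=
  #|\bigcup_(j in S) P j|.

Definition mfsp_optimum (m n : nat) (P : 'I_n -> {set 'I_m})
    (xi : nat) : Prop :=
  (exists2 S : {set 'I_n}, survivable P S & num_fibers P S = xi) /\
  (forall S : {set 'I_n}, survivable P S -> xi <= num_fibers P S).

Definition newly_survived (m n : nat) (P : 'I_n -> {set 'I_m})
    (S : {set 'I_n}) (j : 'I_n) : {set 'I_m} :=
  [set f | survives P j f && [forall i in S, ~~ survives P i f]].

(* A path surviving no new fiber has infinite amortized cost (and not 0, the
   value of a division by zero in [rat]).  The ambiguous case 0/0 is irrelevant:
   a path using no fiber survives all of them, so it survives no new one only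
   if the selected paths already survive every fiber. *)
Definition amortized_cost (m n : nat) (P : 'I_n -> {set 'I_m})
    (S : {set 'I_n}) (j : 'I_n) : \bar rat :=
  if #|newly_survived P S j| == 0 then +oo%E
  else (#|P j|%:R / #|newly_survived P S j|%:R)%R%:E.

(* One iteration, from the set S of selected paths to the set T.  This is a
   relation because ties may be broken arbitrarily. *)
Definition greedy_step (m n : nat) (P : 'I_n -> {set 'I_m})
    (S T : {set 'I_n}) : Prop :=
  ~ survivable P S /\
  exists j : 'I_n,
    [/\ j \notin S,
        forall i : 'I_n, i \notin S ->
          (amortized_cost P S j <= amortized_cost P S i)%E
      & T = j |: S].

Inductive greedy_reachable (m n : nat) (P : 'I_n -> {set 'I_m}) :
    {set 'I_n} -> Prop :=
| greedy_init : greedy_reachable P set0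
| greedy_next (S T : {set 'I_n}) :
    greedy_reachable P S -> greedy_step P S T -> greedy_reachable P T.

(* Halting means that no iteration is possible; that the result is survivable
   is thus not part of the definition. *)
Definition greedy_output (m n : nat) (P : 'I_n -> {set 'I_m})
    (S : {set 'I_n}) : Prop :=
  greedy_reachable P S /\ forall T : {set 'I_n}, ~ greedy_step P S T.

(* Main.v *)
Require Import Defs.
From mathcomp Require Import all_boot all_order all_algebra.
From mathcomp Require Import unstable constructive_ereal reals exp.

Set Implicit Arguments.
Unset Strict Implicit.
Unset Printing Implicit Defensive.

Import Order.TTheory GRing.Theory Num.Theory.

(** MFSP is a set cover problem in disguise: path [j] covers the fibers that it
    survives, at price [#|P j|], except that the objective counts a shared fiber
    once instead of once per path.  The wavelength restriction bounds the price
    of this discrepancy: a fiber is counted at most [W] times in the additive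
    cost [path_cost P O], so the additive cost of an optimal set [O] is at most
    [W * xi] ([path_cost_le]).

    It remains to run the greedy analysis of weighted set cover against the
    additive cost.  When [k] fibers are uncovered and the algorithm selects [j],
    which covers [d] of them, the minimality of the amortized cost of [j],
    averaged over the paths of a survivable set [O], gives
    [#|P j| / d <= path_cost P O / k] ([greedy_choice_cost]).  The selected paths
    are then paid for by the potential [phi k = 1 + ln k], [phi 0 = 0], which
    drops by at least [d / k] when [k] decreases by [d] ([phi_drop]); the total
    cost is at most [phi m * path_cost P O] ([greedy_cost]).

    For [m >= 2], [1 + ln m] is at most [(1 + 1 / ln 2) * ln m].  For [m <= 1]
    the logarithm vanishes, but then a survivable instance has a survivable set
    that uses no fiber, so [xi = 0]. *)

(** * Uncovered fibers and additive cost *)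

Section Instance.

Variables (m n : nat) (P : 'I_n -> {set 'I_m}).
Implicit Types (S T O : {set 'I_n}) (i j : 'I_n).

Definition uncovered S : {set 'I_m} :=
  [set f | [forall i in S, ~~ survives P i f]].

Definition path_cost S : nat := \sum_(j in S) #|P j|.

Lemma uncovered0 : uncovered set0 = setT.
Proof.
by apply/setP=> f; rewrite !inE; apply/forall_inP=> i; rewrite inE.
Qed.

Lemma newly_survivedE S j : newly_survived P S j = uncovered S :\: P j.
Proof. by apply/setP=> f; rewrite !inE. Qed.

Lemma uncoveredU1 S j : uncovered (j |: S) = uncovered S :&: P j.
Proof.
apply/setP=> f; rewrite !inE; apply/forall_inP/andP=> [H|[/forall_inP H fj] i].
  split; last by have := H j (setU11 _ _); rewrite negbK.
  by apply/forall_inP=> i iS; apply: H; rewrite setU1r.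
by case/setU1P=> [->|/H //]; rewrite negbK.
Qed.

Lemma card_uncoveredU1 S j :
  #|uncovered (j |: S)| = #|uncovered S| - #|newly_survived P S j|.
Proof.
by rewrite uncoveredU1 newly_survivedE -(cardsID (P j) (uncovered S)) addnK.
Qed.

Lemma card_newly_survived_le S j :
  #|newly_survived P S j| <= #|uncovered S|.
Proof. by rewrite newly_survivedE subset_leq_card ?subsetDl. Qed.

Lemma survivableP S : reflect (survivable P S) (uncovered S == set0).
Proof.
apply: (iffP eqP) => [S0 f|Ssurv].
  have := in_set0 f; rewrite -S0 inE => /negbT.
  rewrite negb_forall_in => /exists_inP[j jS]; rewrite negbK.
  by exists j.
apply/setP=> f; rewrite !inE; apply/negP => /forall_inP H.
by have [j jS jf] := Ssurv f; have := H j jS; rewrite jf.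
Qed.

Lemma newly_survived_selected S j : j \in S -> newly_survived P S j = set0.
Proof.
move=> jS; apply/setP=> f; rewrite newly_survivedE !inE.
by apply/andP=> -[fj /forall_inP/(_ j jS)]; rewrite negbK (negbTE fj).
Qed.

Lemma num_fibers_le_cost S : num_fibers P S <= path_cost S.
Proof. exact: card_big_setU. Qed.

(** Double counting of the pairs of a path of [S] and a fiber that it uses: only
    the fibers of the union contribute, at most [W] pairs each. *)
Lemma path_cost_le W S :
  wavelength_restricted P W -> path_cost S <= W * num_fibers P S.
Proof.
move=> PW; rewrite /path_cost /num_fibers.
under eq_bigr do rewrite -sum1_card.
rewrite (exchange_big_dep (mem (\bigcup_(j in S) P j))) /=; last first.
  by move=> j f jS fj; apply/bigcupP; exists j.
rewrite mulnC -sum_nat_const; apply: leq_sum => f _.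
rewrite sum1_card; apply: leq_trans (PW f).
by apply: subset_leq_card; apply/subsetP=> j; rewrite !inE => /andP[].
Qed.

(** Every uncovered fiber is newly survived by some path of a survivable set. *)
Lemma uncovered_le_newly_survived S O : survivable P O ->
  #|uncovered S| <= \sum_(i in O) #|newly_survived P S i|.
Proof.
move=> Osurv.
apply: (@leq_trans #|\bigcup_(i in O) newly_survived P S i|).
  apply: subset_leq_card; apply/subsetP=> f fS.
  have [i iO fi] := Osurv f; apply/bigcupP; exists i => //.
  by rewrite newly_survivedE inE fS andbT.
exact: card_big_setU.
Qed.

(** With at most one fiber, a path that survives it uses no fiber at all. *)
Lemma mfsp_optimum_small xi : m <= 1 -> mfsp_optimum P xi -> xi = 0.
Proof.
move=> m1 [[O Osurv Oxi] optxi].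
have [m0|m_gt0] := posnP m.
  apply/eqP; rewrite -leqn0 -Oxi /num_fibers -[X in _ <= X]m0.
  by rewrite -[X in _ <= X]card_ord max_card.
pose f0 := Ordinal m_gt0.
have all_f0 (f : 'I_m) : f = f0.
  by apply: val_inj => /=; apply/eqP; rewrite -leqn0 -ltnS (leq_trans _ m1).
have [j _ fj] := Osurv f0.
have Pj0 : P j = set0.
  by apply/setP=> f; rewrite inE (all_f0 f); apply: negbTE.
have : survivable P [set j].
  by move=> f; exists j; rewrite ?set11 // (all_f0 f).
by move/optxi; rewrite /num_fibers big_set1 Pj0 cards0 leqn0 => /eqP.
Qed.

(** * The greedy choice *)

(** The cross-multiplied form of the comparison of amortized costs is also true
    when one of them is infinite, which spares the averaging argument any case
    distinction: a chosen path of infinite cost forces every path to survive no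
    new fiber. *)
Lemma greedy_choice_le S j :
  (forall i, i \notin S -> (amortized_cost P S j <= amortized_cost P S i)%E) ->
  forall i, #|P j| * #|newly_survived P S i|
            <= #|newly_survived P S j| * #|P i|.
Proof.
move=> minj i; have [iS|/minj] := boolP (i \in S).
  by rewrite newly_survived_selected // cards0 muln0.
rewrite /amortized_cost; case: (eqVneq #|newly_survived P S i| 0) => [-> _|i0].
  by rewrite muln0.
case: (eqVneq #|newly_survived P S j| 0) => [_|j0]; first by rewrite leye_eq.
rewrite lee_fin ler_pdivrMr ?ltr0n ?lt0n // mulrAC ler_pdivlMr ?ltr0n ?lt0n //.
by rewrite -!natrM ler_nat [X in _ <= X]mulnC.
Qed.

(** The cheapest path is at least as cheap, per newly survived fiber, as the
    paths of [O] are on average. *)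
Lemma greedy_choice_cost S O j : survivable P O ->
  (forall i, i \notin S -> (amortized_cost P S j <= amortized_cost P S i)%E) ->
  #|P j| * #|uncovered S| <= #|newly_survived P S j| * path_cost O.
Proof.
move=> Osurv /greedy_choice_le minj.
apply: (@leq_trans (#|P j| * \sum_(i in O) #|newly_survived P S i|)).
  by rewrite leq_mul2l uncovered_le_newly_survived ?orbT.
by rewrite /path_cost !big_distrr /=; apply: leq_sum.
Qed.

(** * Termination *)

Lemma greedy_step_wf : well_founded (fun T S => greedy_step P S T).
Proof.
move=> S; have [k] := ubnP #|~: S|; elim: k S => [S|k IHk S leSk]; first by rewrite ltn0.
constructor=> T [_ [j [jS _ ->]]]; apply: IHk.
move: leSk; rewrite ltnS; apply: leq_trans; apply: proper_card; rewrite properC properE subsetUr /=.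
by apply/subsetPn; exists j; rewrite ?setU11.
Qed.

(** As long as a fiber is uncovered, a path of a survivable set that survives
    this fiber is still to be selected, so a cheapest remaining path exists. *)
Lemma greedy_progress S O : survivable P O -> ~ survivable P S ->
  exists T, greedy_step P S T.
Proof.
move=> Osurv nS; have /survivableP/set0Pn[f fS] := nS.
have [j0 _ fj0] := Osurv f.
have j0S : j0 \notin S.
  move: fS; rewrite inE => /forall_inP H.
  by apply/negP => /H; rewrite fj0.
case: (@arg_minP _ _ _ j0 (fun j => j \notin S) (amortized_cost P S) j0S)
  => j jS minj.
by exists (j |: S); split=> //; exists j.
Qed.

Lemma greedy_output_survivable S O :
  survivable P O -> greedy_output P S -> survivable P S.
Proof.
move=> Osurv [_ Sstop]; have [/survivableP //|/survivableP nS] :=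
  boolP (uncovered S == set0).
by have [T /Sstop] := greedy_progress Osurv nS.
Qed.

Lemma greedy_output_exists O :
  survivable P O -> exists S, greedy_output P S.
Proof.
move=> Osurv; suff: forall S, greedy_reachable P S -> exists T, greedy_output P T.
  by apply; apply: greedy_init.
move=> S; elim/(well_founded_ind greedy_step_wf): S => S IH Sreach.
have [/survivableP Ssurv|/survivableP nS] := boolP (uncovered S == set0).
  by exists S; split=> // T [].
have [T ST] := greedy_progress Osurv nS.
by apply: (IH T ST); apply: greedy_next ST.
Qed.

End Instance.

(** * The logarithmic potential *)

Section Potential.

Variable R : realType.
Local Open Scope ring_scope.

(** This is a closed form above the harmonic numbers that still satisfies the
    inequality that telescopes. *)
Definition phi (k : nat) : R := if k == 0%N then 0 else 1 + ln k%:R.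

Lemma phi_ge0 k : 0 <= phi k.
Proof.
by rewrite /phi; case: k => //= k; rewrite addr_ge0 // ln_ge0 // ler1n.
Qed.

(** If [d < k] this is [ln x <= x - 1] at [x = (k - d) / k]; if [d = k], the
    summand [1] of [phi] pays for the drop. *)
Lemma phi_drop k d : (0 < k)%N -> (d <= k)%N ->
  d%:R / k%:R + phi (k - d) <= phi k.
Proof.
move=> k0 dk; have kR0 : 0 < k%:R :> R by rewrite ltr0n.
rewrite /phi (gtn_eqF k0) subn_eq0; case: leqP => [kd|d_lt_k].
  have -> : d = k by apply/eqP; rewrite eqn_leq dk.
  by rewrite divff ?gt_eqF // addr0 lerDl ln_ge0 // ler1n.
have kdR0 : 0 < (k - d)%:R :> R by rewrite ltr0n subn_gt0.
have xE : (k - d)%:R / k%:R = 1 + - (d%:R / k%:R) :> R.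
  by rewrite natrB // mulrBl divff ?gt_eqF.
have := @le_ln1Dx R (- (d%:R / k%:R)).
rewrite -xE ln_div ?posrE // => H.
rewrite addrCA lerD2l -lerBrDr -lerN2 opprB; apply: H.
by rewrite ltrN2 ltr_pdivrMr // mul1r ltr_nat.
Qed.

(** The cost so far plus [path_cost P O] times the potential of the uncovered
    fibers never increases: by [greedy_choice_cost] a step that covers [d] of [k]
    fibers costs at most [d / k * path_cost P O], which the drop of the potential
    pays for. *)
Lemma greedy_cost (m n : nat) (P : 'I_n -> {set 'I_m}) (S O : {set 'I_n}) :
  survivable P O -> greedy_reachable P S ->
  (path_cost P S)%:R <= phi m * (path_cost P O)%:R.
Proof.
move=> Osurv Sreach; set B : R := (path_cost P O)%:R.
have B0 : 0 <= B by rewrite ler0n.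
suff inv : (path_cost P S)%:R + phi #|uncovered P S| * B <= phi m * B.
  by apply: le_trans inv; rewrite lerDl mulr_ge0 ?phi_ge0.
elim: Sreach => {S} [|S T _ IH [nS [j [jS minj ->]]]].
  by rewrite uncovered0 cardsT card_ord /path_cost big_set0 add0r.
apply: le_trans IH.
have k0 : (0 < #|uncovered P S|)%N.
  by rewrite card_gt0; apply/survivableP.
rewrite /path_cost big_setU1 //= natrD addrAC [leRHS]addrC lerD2r.
rewrite card_uncoveredU1.
have := phi_drop k0 (card_newly_survived_le P S j).
move/(ler_wpM2r B0); apply: le_trans; rewrite mulrDl lerD2r mulrAC.
rewrite ler_pdivlMr ?ltr0n // -!natrM ler_nat.
exact: greedy_choice_cost.
Qed.

End Potential.

Theorem theorem7 (R : realType) :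
  exists2 c : R, (0 < c)%R &
    forall (m n W : nat) (P : 'I_n -> {set 'I_m}),
      wavelength_restricted P W ->
      (exists S : {set 'I_n}, survivable P S) ->
      [/\ well_founded (fun T S : {set 'I_n} => greedy_step P S T),
          exists S : {set 'I_n}, greedy_output P S
        & forall S : {set 'I_n}, greedy_output P S ->
            survivable P S /\
            forall xi : nat, mfsp_optimum P xi ->
              ((num_fibers P S)%:R <= c * (W%:R * ln m%:R) * xi%:R)%R].
Proof.
have ln2_gt0 : (0 < ln 2 :> R)%R by rewrite ln_gt0 // ltr1n.
exists (1 + (ln 2)^-1)%R; first by rewrite addr_gt0 ?invr_gt0.
move=> m n W P PW [O0 O0surv]; split.
- exact: greedy_step_wf.
- exact: greedy_output_exists O0surv.
move=> S Sout; split; first exact: greedy_output_survivable O0surv Sout.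
move=> xi xi_opt; have [[O Osurv Oxi] _] := xi_opt.
have cost_le : ((num_fibers P S)%:R <= phi R m * (W * xi)%:R :> R)%R.
  apply: (@le_trans _ _ (path_cost P S)%:R%R).
    by rewrite ler_nat num_fibers_le_cost.
  apply: le_trans (greedy_cost R Osurv (proj1 Sout)) _.
  by rewrite ler_wpM2l ?phi_ge0 // ler_nat -Oxi path_cost_le.
have [m1|m2] := leqP m 1.
  move: cost_le; rewrite (mfsp_optimum_small m1 xi_opt).
  by rewrite muln0 !mulr0.
apply: le_trans cost_le _.
(* What is left is [1 + ln m <= (1 + 1 / ln 2) * ln m], as [ln 2 <= ln m]. *)
rewrite natrM [X in (_ <= X * _)%R]mulrCA [X in (_ <= X * _)%R]mulrC -mulrA.
rewrite ler_wpM2r ?mulr_ge0 ?ler0n //.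
rewrite /phi gtn_eqF ?(ltnW m2) // mulrDl mul1r addrC lerD2l.
rewrite mulrC ler_pdivlMr // mul1r ler_ln ?posrE ?ltr0n ?ler_nat //.
exact: ltnW.
Qed.
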